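(* Let $p$ be a prime, $t\ge0$ an integer with $p^t+1\mid p^n-1$, and $F\colon\mathbb F_p^n\to\mathbb F_p^n$ a plateaued function that is $(p^t+1)$-to-$1$. Then $F$ has differential uniformity at least $p^t$. Moreover, $F$ has differential uniformity exactly $p^t$ if and only if for every nonzero $a\in\mathbb F_p^n$ and every $b\in\mathbb F_p^n$ the equation $F(x+a)-F(x)=b$ has either $0$ or $p^t$ solutions $x\in\mathbb F_p^n$.
   Context: Standard scalar product, $\zeta_p=e^{2\pi i/p}$, components $F_b(x)=\langle b,F(x)\rangle$ with $W_F(b,a)=\sum_x\zeta_p^{F_b(x)-\langle a,x\rangle}$. A function $f$ is $s$-plateaued if $|W_f(a)|\in\{0,p^{(n+s)/2}\}$ for all $a$; $F$ is plateaued if every $F_b$, $b\neq0$, is $s_b$-plateaued for some $s_b$. $F$ is $d$-to-$1$ if $d\mid p^n-1$ and $F$ has exactly one preimage set of size $1$ and all other nonempty preimage sets have size $d$. The differential uniformity of $F$ is the maximum, over $a\neq0$ and all $b$, of the number of solutions $x$ of $F(x+a)-F(x)=b$. *)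

(* Defs.v *)
From HB Require Import structures.
From mathcomp Require Import all_boot all_order all_algebra.
From mathcomp Require Import complex.
From mathcomp Require Import reals exp trigo.

Set Implicit Arguments.
Unset Strict Implicit.
Unset Printing Implicit Defensive.

Import Order.TTheory GRing.Theory Num.Theory.

Local Open Scope ring_scope.
Local Open Scope complex_scope.

Definition zeta (R : realType) (p : nat) : R[i] :=
  cos (2 * pi / p%:R) +i* sin (2 * pi / p%:R).

Definition scalar_prod (p n : nat) (x y : 'rV['F_p]_n) : 'F_p :=
  \sum_(i < n) x 0 i * y 0 i.

Definition component (p n m : nat) (F : 'rV['F_p]_n -> 'rV['F_p]_m)
    (b : 'rV['F_p]_m) (x : 'rV['F_p]_n) : 'F_p :=
  scalar_prod b (F x).

(* The exponent is an element of 'F_p, read through its representative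
   in {0, ..., p - 1} (for p prime); zeta R p has order p. *)
Definition walsh (R : realType) (p n : nat) (f : 'rV['F_p]_n -> 'F_p)
    (a : 'rV['F_p]_n) : R[i] :=
  \sum_(x : 'rV['F_p]_n) zeta R p ^+ nat_of_ord (f x - scalar_prod a x).

Definition s_plateaued (R : realType) (p n s : nat)
    (f : 'rV['F_p]_n -> 'F_p) : Prop :=
  forall a : 'rV['F_p]_n,
    `|walsh R f a| = 0 \/
    `|walsh R f a| = (p%:R `^ ((n + s)%N%:R / 2))%:C.

Definition plateaued (R : realType) (p n m : nat)
    (F : 'rV['F_p]_n -> 'rV['F_p]_m) : Prop :=
  forall b : 'rV['F_p]_m, b != 0 ->
    exists s : nat, s_plateaued R s (component F b).

Definition fiber (p n m : nat) (F : 'rV['F_p]_n -> 'rV['F_p]_m)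
    (y : 'rV['F_p]_m) : {set 'rV['F_p]_n} :=
  [set x | F x == y].

Definition d_to_1 (p n m d : nat) (F : 'rV['F_p]_n -> 'rV['F_p]_m) : Prop :=
  [/\ (d %| p ^ n - 1)%N,
      exists! y : 'rV['F_p]_m, #|fiber F y| = 1%N
    & forall y : 'rV['F_p]_m,
        #|fiber F y| <> 1%N -> fiber F y <> set0 -> #|fiber F y| = d].

Definition diff_solutions (p n m : nat) (F : 'rV['F_p]_n -> 'rV['F_p]_m)
    (a : 'rV['F_p]_n) (b : 'rV['F_p]_m) : {set 'rV['F_p]_n} :=
  [set x | F (x + a) - F x == b].

Definition diff_uniformity (p n m : nat)
    (F : 'rV['F_p]_n -> 'rV['F_p]_m) : nat :=
  (\max_(a : 'rV['F_p]_n | a != 0%R)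
     \max_(b : 'rV['F_p]_m) #|diff_solutions F a b|)%N.

(* Main.v *)
(* Write N(h, c) for the number of solutions of F(x + h) - F(x) = c, d = p^t + 1
   and q = p^n. By Plancherel, sum_{a,b} |W(b,a)|^4 = q^2 sum_{h,c} N(h,c)^2.
   Since F is d-to-1, W(b,0) is a root of unity plus d times an algebraic
   integer, hence nonzero, so plateauedness gives |W(b,a)| in {0, |W(b,0)|}
   and, by Parseval, sum_a |W(b,a)|^4 = q^2 |W(b,0)|^2. Finally
   sum_b |W(b,0)|^2 = q sum_y |F^-1(y)|^2 is determined by the fiber sizes.
   Removing the terms with h = 0 leaves
   sum_{h != 0, c} N(h,c) (N(h,c) - p^t) = 0, from which both claims follow. *)
Require Import Defs.
From mathcomp Require Import all_boot all_order all_algebra.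
From mathcomp Require Import complex.
From mathcomp Require Import reals exp trigo.
From mathcomp Require Import ring lra zify.

Import GRing.Theory.
Local Open Scope ring_scope.

Set Implicit Arguments.
Unset Strict Implicit.

Import Order.TTheory Num.Theory.
Local Open Scope complex_scope.

(** * Integrality of 1/d and the root of unity [zeta] *)

(** Rational root argument: multiplying the monic integer equation satisfied by 1/d by d to its
    degree leaves the leading coefficient 1 plus multiples of d, so d divides 1. *)
Lemma integral_inv_nat (K : numFieldType) (d : nat) :
  (0 < d)%N -> integralOver (intr : int -> K) (d%:R)^-1 -> (d <= 1)%N.
Proof.
move=> d_gt0 [q q_monic].
have d_neq0 : d%:R != 0 :> K by rewrite pnatr_eq0 -lt0n.
rewrite rootE horner_coef size_map_inj_poly //; last exact: intr_inj.
move=> /eqP q_root.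
have s_gt0 : (0 < size q)%N by rewrite size_poly_gt0 monic_neq0.
have : \sum_(i < size q) q`_i * d%:Z ^+ ((size q).-1 - i) = 0.
  apply: (@intr_inj K); rewrite rmorph_sum rmorph0 /=.
  rewrite -[RHS](mul0r (d%:R ^+ (size q).-1)).
  rewrite -[X in _ = X * _]q_root mulr_suml.
  apply: eq_bigr => i _; rewrite coef_map rmorphM rmorphXn /= -mulrA.
  congr (_ * _); have i_le : (i <= (size q).-1)%N by rewrite -ltnS prednK.
  rewrite -[in RHS](subnK i_le) exprD mulrCA exprVn mulVf ?mulr1 //.
  by rewrite expf_neq0.
move: (monicP q_monic) s_gt0; rewrite /lead_coef.
case: (size q) => // s /= q_s _.
rewrite big_ord_recr /= q_s subnn expr0 mulr1 => sum0.
suff : (d%:Z %| 1%R)%Z by rewrite dvdzE /= dvdn1 => /eqP->.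
have -> : 1 = - \sum_(i < s) q`_i * d%:Z ^+ (s - i).
  by apply/eqP; rewrite -addr_eq0 addrC sum0.
rewrite rpredN; apply: rpred_sum => i _.
by rewrite dvdz_mull // dvdz_exp // subn_gt0.
Qed.

(** De Moivre's formula. *)
Lemma expr_cosi (R : realType) (x : R) (k : nat) :
  (cos x +i* sin x) ^+ k = cos (x *+ k) +i* sin (x *+ k).
Proof.
elim: k => [|k IHk]; first by rewrite expr0 !mulr0n cos0 sin0.
rewrite exprS IHk mulrS cosD sinD.
apply/eqP; rewrite eq_complex /= eqxx /= addrC mulrC.
by apply/eqP; congr (_ + _); rewrite mulrC.
Qed.

Lemma zeta_expp (R : realType) (p : nat) : prime p -> zeta R p ^+ p = 1.
Proof.
move=> /prime_gt0 p_gt0; rewrite /zeta expr_cosi.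
rewrite -[_ *+ p]mulr_natr mulfVK ?pnatr_eq0 -?lt0n //.
by rewrite mulr_natl cos2pi sin2pi.
Qed.

Lemma zeta_neq1 (R : realType) (p : nat) : prime p -> zeta R p != 1.
Proof.
move=> p_prime; have p_gt1 := prime_gt1 p_prime.
apply/negP; rewrite eq_complex /= => /andP[/eqP cos_eq1 /eqP sin_eq0].
have pi0 := pi_gt0 R.
(* For p = 2 the angle is pi, where the sine vanishes but the cosine is -1; for p > 2 it lies
   strictly between 0 and pi, where the sine is positive. *)
have [p_eq2|p_gt2] : p = 2%N \/ (2 < p)%N by lia.
  move: cos_eq1; rewrite p_eq2 mulrAC divff ?pnatr_eq0 // mul1r cospi => ?.
  by lra.
suff : 0 < sin (2 * pi / p%:R : R) by rewrite sin_eq0 ltxx.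
have p0 : 0 < p%:R :> R by rewrite ltr0n; lia.
apply: sin_gt0_pi; rewrite divr_gt0 ?mulr_gt0 //= ltr_pdivrMr //.
by rewrite mulrC ltr_pM2l // ltr_nat.
Qed.

(** * The space of vectors over 'F_p and its scalar product *)

Lemma card_rVFp (p n : nat) : prime p -> #|{: 'rV['F_p]_n}| = (p ^ n)%N.
Proof. by move=> p_prime; rewrite card_mx card_Fp // mul1n. Qed.

Lemma scalar_prodC p n (x y : 'rV['F_p]_n) :
  scalar_prod x y = scalar_prod y x.
Proof. by apply: eq_bigr => i _; rewrite mulrC. Qed.

Lemma scalar_prodDr p n (a x y : 'rV['F_p]_n) :
  scalar_prod a (x + y) = scalar_prod a x + scalar_prod a y.
Proof. by rewrite -big_split; apply: eq_bigr => i _; rewrite mxE mulrDr. Qed.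

Lemma scalar_prodNr p n (a x : 'rV['F_p]_n) :
  scalar_prod a (- x) = - scalar_prod a x.
Proof. by rewrite -sumrN; apply: eq_bigr => i _; rewrite mxE mulrN. Qed.

Lemma scalar_prod0l p n (x : 'rV['F_p]_n) : scalar_prod 0 x = 0.
Proof. by apply: big1 => i _; rewrite mxE mul0r. Qed.

Lemma scalar_prod_eq1 p n (a : 'rV['F_p]_n) :
  a != 0 -> exists x, scalar_prod a x = 1.
Proof.
move=> /rV0Pn[i ai_neq0]; exists ((a 0 i)^-1 *: delta_mx 0 i).
rewrite /scalar_prod (bigD1 i) //= !mxE !eqxx mulr1 divff // big1 ?addr0 //.
by move=> j /negPf ji; rewrite !mxE ji andbF !mulr0.
Qed.

(** * Character sums and Plancherel's identity *)

Section Characters.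

Variables (R : realType) (p : nat).
Hypothesis p_prime : prime p.
Let chi (u : 'F_p) : R[i] := zeta R p ^+ nat_of_ord u.

Lemma chiD u v : chi (u + v) = chi u * chi v.
Proof.
rewrite /chi -exprD -(expr_mod (u + v)%N (zeta_expp R p_prime)) /=.
(* Addition in 'F_p reduces modulo an encoded modulus, which [Fp_cast] identifies with p for p
   prime. *)
by congr (_ ^+ (_ %% _)); apply: Fp_cast.
Qed.

Lemma chi0 : chi 0 = 1. Proof. by []. Qed.

Lemma chi1_neq1 : chi 1 != 1.
Proof. by rewrite /chi /= expr1 zeta_neq1. Qed.

(** A root of unity has modulus 1, so its conjugate is its inverse. *)
Lemma chi_conj u : (chi u)^*%R = chi (- u).
Proof.
have chiN : chi u * chi (- u) = 1 by rewrite -chiD subrr.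
have norm_chi : `|chi u| = 1.
  rewrite normrX; suff -> : `|zeta R p| = 1 by rewrite expr1n.
  apply/eqP; rewrite -(@pexpr_eq1 _ _ p) ?prime_gt0 //.
  by rewrite -normrX zeta_expp // normr1.
have chi_neq0 : chi u != 0 by rewrite -normr_eq0 norm_chi oner_eq0.
by apply: (mulfI chi_neq0); rewrite chiN -normCK norm_chi expr1n.
Qed.

(** For a nonzero, translating x by some v with <a, v> = 1 multiplies the sum by [chi 1], which
    differs from 1. *)
Lemma sum_chi n (a : 'rV['F_p]_n) :
  \sum_x chi (scalar_prod a x) = if a == 0 then (p ^ n)%:R else 0.
Proof.
have [->|/scalar_prod_eq1[v av1]] := eqVneq a 0.
  under [LHS]eq_bigr do rewrite scalar_prod0l.
  by rewrite sumr_const card_rVFp.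
apply/eqP; set S := \sum_x _.
have : S = chi 1 * S.
  rewrite /S mulr_sumr (reindex_inj (addrI v)).
  by apply: eq_bigr => x _; rewrite scalar_prodDr chiD av1.
move=> /eqP; rewrite -subr_eq0 -{1}[S]mul1r -mulrBl mulf_eq0 subr_eq0.
by rewrite eq_sym (negPf chi1_neq1).
Qed.

(** Expanding the square and summing over a first, orthogonality leaves only the diagonal x = y. *)
Lemma plancherel n (g : 'rV['F_p]_n -> R[i]) :
  \sum_a `|\sum_x g x * chi (scalar_prod a x)| ^+ 2 =
  (p ^ n)%:R * \sum_x `|g x| ^+ 2.
Proof.
transitivity (\sum_a \sum_x \sum_y
    g x * (g y)^*%R * chi (scalar_prod (x - y) a)).
  apply: eq_bigr => a _; rewrite normCK rmorph_sum mulr_suml.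
  apply: eq_bigr => x _; rewrite mulr_sumr; apply: eq_bigr => y _.
  rewrite rmorphM /= chi_conj mulrACA -chiD.
  by rewrite -scalar_prodNr -scalar_prodDr scalar_prodC.
rewrite exchange_big mulr_sumr; apply: eq_bigr => x _.
rewrite exchange_big (bigD1 x) //= -mulr_sumr subrr sum_chi eqxx.
rewrite mulrC -normCK big1 ?addr0 // => y yx.
by rewrite -mulr_sumr sum_chi subr_eq0 eq_sym (negPf yx) mulr0.
Qed.

Lemma plancherel_opp n (g : 'rV['F_p]_n -> R[i]) :
  \sum_a `|\sum_x g x * chi (- scalar_prod a x)| ^+ 2 =
  (p ^ n)%:R * \sum_x `|g x| ^+ 2.
Proof.
rewrite -plancherel (reindex_inj oppr_inj); apply: eq_bigr => a _.
congr (`| _ | ^+ 2); apply: eq_bigr => x _; congr (_ * chi _).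
by rewrite scalar_prodC scalar_prodNr opprK scalar_prodC.
Qed.

(** Exhibits the sum as the Fourier transform of the fiber-size function, so that [plancherel]
    applies in b. *)
Lemma sum_chi_comp n (G : 'rV['F_p]_n -> 'rV['F_p]_n) b :
  \sum_x chi (scalar_prod b (G x)) =
  \sum_y #|fiber G y|%:R * chi (scalar_prod b y).
Proof.
rewrite (partition_big G predT) //=; apply: eq_bigr => y _.
rewrite -sum1_card natr_sum mulr_suml.
by apply: eq_big => [x|x /eqP ->]; rewrite ?mul1r ?inE.
Qed.

Lemma sum_norm_sqr_comp n (G : 'rV['F_p]_n -> 'rV['F_p]_n) :
  \sum_b `|\sum_x chi (scalar_prod b (G x))| ^+ 2 =
  (p ^ n * \sum_y #|fiber G y| ^ 2)%:R.
Proof.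
under [LHS]eq_bigr do rewrite (sum_chi_comp G).
rewrite plancherel natrM natr_sum; congr (_ * _); apply: eq_bigr => y _.
by rewrite normr_nat natrX.
Qed.

(** * Second and fourth moments of the Walsh transform *)

Lemma walshE n (f : 'rV['F_p]_n -> 'F_p) a :
  walsh R f a = \sum_x chi (f x) * chi (- scalar_prod a x).
Proof. by apply: eq_bigr => x _; rewrite -chiD. Qed.

Lemma parseval n (f : 'rV['F_p]_n -> 'F_p) :
  \sum_a `|walsh R f a| ^+ 2 = (p ^ n * p ^ n)%:R.
Proof.
under [LHS]eq_bigr do rewrite walshE.
rewrite plancherel_opp natrM; congr (_ * _).
rewrite -[X in X%:R](card_rVFp n p_prime) -sumr_const.
by apply: eq_bigr => x _; rewrite normCK chi_conj -chiD subrr.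
Qed.

(** The squared modulus is, as a function of a, the Fourier transform of the autocorrelation in h
    ([sqE]). Plancherel in a, then in b for each map x -> F(x + h) - F(x), whose fibers are the
    solution sets, gives the count. *)
Lemma sum_walsh_fourth n (F : 'rV['F_p]_n -> 'rV['F_p]_n) :
  \sum_b \sum_a `|walsh R (component F b) a| ^+ 4 =
  (p ^ n * p ^ n * \sum_h \sum_c #|diff_solutions F h c| ^ 2)%:R.
Proof.
have sqE b a : `|walsh R (component F b) a| ^+ 2 =
    \sum_h (\sum_x chi (scalar_prod b (F (x + h) - F x))) *
      chi (- scalar_prod a h).
  rewrite walshE normCK rmorph_sum mulr_sumr.
  under [RHS]eq_bigr do rewrite mulr_suml.
  rewrite [RHS]exchange_big; apply: eq_bigr => x _.
  rewrite mulr_suml (reindex_inj (addrI x)); apply: eq_bigr => h _.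
  rewrite rmorphM /= !chi_conj -!chiD /component; congr chi.
  by rewrite !scalar_prodDr !scalar_prodNr; ring.
transitivity (\sum_b (p ^ n)%:R *
    \sum_h `|\sum_x chi (scalar_prod b (F (x + h) - F x))| ^+ 2).
  apply: eq_bigr => b _; rewrite -plancherel_opp; apply: eq_bigr => a _.
  by rewrite -sqE normrX normr_id -exprM.
rewrite -mulr_sumr exchange_big -mulnA natrM [in RHS]big_distrr natr_sum.
by congr (_ * _); apply: eq_bigr => h _; rewrite (sum_norm_sqr_comp (fun x => F (x + h) - F x)).
Qed.

(** * Nonvanishing at 0 and flat Walsh spectra *)

Lemma integral_chi u : integralOver (intr : int -> R[i]) (chi u).
Proof.
exists ('X^p - 1%:P); first exact/monicXnsubC/prime_gt0.
rewrite rmorphB /= map_polyXn map_polyC /= rootE !hornerE.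
by rewrite /chi exprAC zeta_expp // expr1n subrr.
Qed.

(* Modulo d the sum is a root of unity, and 1/d is not an algebraic integer. *)
Lemma sum_chi_neq0 n d (F : 'rV['F_p]_n -> 'rV['F_p]_n) b :
  (1 < d)%N -> d_to_1 d F -> \sum_x chi (scalar_prod b (F x)) != 0.
Proof.
move=> d_gt1 [_ [y0 [y0_fib y0_uniq]] other_fib]; rewrite (sum_chi_comp F).
apply/eqP => sum0.
pose S := \sum_(y | y != y0) (fiber F y != set0)%:R * chi (scalar_prod b y).
have fib_eq : chi (scalar_prod b y0) = - (d%:R * S).
  apply/eqP; rewrite -addr_eq0 -[X in _ == X]sum0 (bigD1 y0) //= y0_fib mul1r.
  apply/eqP; congr (_ + _); rewrite mulr_sumr; apply: eq_bigr => y yy0.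
  rewrite mulrA -natrM; congr (_%:R * _).
  have [->|/eqP fib_neq0] := eqVneq (fiber F y) set0.
    by rewrite cards0 muln0.
  rewrite muln1; apply/esym/other_fib => //.
  by move=> /y0_uniq y0y; rewrite y0y eqxx in yy0.
have d_neq0 : d%:R != 0 :> R[i] by rewrite pnatr_eq0; lia.
suff /(integral_inv_nat (ltnW d_gt1)) :
    integralOver (intr : int -> R[i]) (d%:R)^-1 by lia.
have -> : (d%:R)^-1 = - (S * chi (- scalar_prod b y0)).
  apply: (mulfI d_neq0); rewrite divff // mulrN mulrA -mulNr -fib_eq.
  by rewrite -chiD subrr.
apply/integral_opp/integral_mul/integral_chi.
apply: (big_ind (integralOver (intr : int -> R[i]))).
- exact: integral0.
- exact: integral_add.
- move=> y _; apply/integral_mul/integral_chi; exact: integral_nat.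
Qed.

(** The nonzero value at 0 forces r to be its modulus, and Parseval concludes. Leaving r arbitrary
    lets the lemma cover the component b = 0 as well. *)
Lemma sum_flat_walsh_fourth n (f : 'rV['F_p]_n -> 'F_p) (r : R[i]) :
    (forall a, `|walsh R f a| = 0 \/ `|walsh R f a| = r) -> walsh R f 0 != 0 ->
  \sum_a `|walsh R f a| ^+ 4 = `|walsh R f 0| ^+ 2 * (p ^ n * p ^ n)%:R.
Proof.
move=> flat W0_neq0; rewrite -(parseval f) mulr_sumr; apply: eq_bigr => a _.
have -> : `|walsh R f 0| = r.
  by case: (flat 0) => // /normr0_eq0 W0; rewrite W0 eqxx in W0_neq0.
case: (flat a) => ->; first by rewrite !expr0n mulr0.
by rewrite -exprD.
Qed.

Lemma walsh0 n (F : 'rV['F_p]_n -> 'rV['F_p]_n) b :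
  walsh R (component F b) 0 = \sum_x chi (scalar_prod b (F x)).
Proof.
rewrite walshE; apply: eq_bigr => x _.
by rewrite scalar_prod0l oppr0 chi0 mulr1.
Qed.

(* This includes b = 0, where the transform is q at 0 and vanishes elsewhere. *)
Lemma walsh_flat n (F : 'rV['F_p]_n -> 'rV['F_p]_n) b : plateaued R F ->
  exists r, forall a, `|walsh R (component F b) a| = 0 \/
                      `|walsh R (component F b) a| = r.
Proof.
move=> F_plat; have [->|/F_plat[s bs]] := eqVneq b 0; last first.
  by exists (p%:R `^ ((n + s)%N%:R / 2))%:C.
exists (p ^ n)%:R => a.
have -> : walsh R (component F 0) a = \sum_x chi (scalar_prod (- a) x).
  rewrite walshE; apply: eq_bigr => x _; rewrite /component scalar_prod0l.
  by rewrite chi0 mul1r scalar_prodC -scalar_prodNr scalar_prodC.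
rewrite sum_chi; case: eqP => _; last by left; rewrite normr0.
by right; rewrite normr_nat.
Qed.

End Characters.

(** * Counting fibers and solutions of difference equations *)

Lemma sum_fiber_card p n (G : 'rV['F_p]_n -> 'rV['F_p]_n) : prime p ->
  (\sum_y #|fiber G y| = p ^ n)%N.
Proof.
move=> p_prime; rewrite -(card_rVFp n p_prime) -[RHS]sum1_card.
rewrite [RHS](partition_big G predT) //=; apply: eq_bigr => y _.
by rewrite -sum1_card; apply: eq_bigl => x; rewrite inE.
Qed.

(** Each fiber size k satisfies k^2 = d k, except the single fiber of size 1, which contributes 1
    instead of d; the additive form avoids truncated subtraction. *)
Lemma sum_fiber_card_sqr p n d (F : 'rV['F_p]_n -> 'rV['F_p]_n) :
  prime p -> d_to_1 d F ->
  (\sum_y #|fiber F y| ^ 2 + d = d * p ^ n + 1)%N.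
Proof.
move=> p_prime [_ [y0 [y0_fib y0_uniq]] other_fib].
rewrite -(sum_fiber_card F p_prime) big_distrr.
rewrite (bigD1 y0) //= [in RHS](bigD1 y0) //= y0_fib.
rewrite (eq_bigr (fun y => d * #|fiber F y|)%N); first by rewrite /= exp1n muln1; lia.
move=> y yy0; have [->|/eqP fib_neq0] := eqVneq (fiber F y) set0.
  by rewrite cards0 muln0.
rewrite other_fib //.
by move=> /y0_uniq y0y; rewrite y0y eqxx in yy0.
Qed.

Lemma sum_diff_solutions0_sqr p n (F : 'rV['F_p]_n -> 'rV['F_p]_n) :
  prime p -> (\sum_c #|diff_solutions F 0 c| ^ 2 = p ^ n * p ^ n)%N.
Proof.
move=> p_prime; rewrite (bigD1 0) //= big1 ?addn0 => [|c c_neq0].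
  rewrite mulnn -(card_rVFp n p_prime); congr (_ ^ _)%N; apply: eq_card => x.
  by rewrite !inE addr0 subrr eqxx.
suff -> : diff_solutions F 0 c = set0 by rewrite cards0.
by apply/setP => x; rewrite !inE addr0 subrr eq_sym (negPf c_neq0).
Qed.

Lemma sum_diff_solutions_sqr (R : realType) p n d
    (F : 'rV['F_p]_n -> 'rV['F_p]_n) :
  prime p -> (1 < d)%N -> plateaued R F -> d_to_1 d F ->
  (\sum_(h | h != 0%R) \sum_c #|diff_solutions F h c| ^ 2 =
   (d - 1) * \sum_(h : 'rV['F_p]_n | h != 0%R) \sum_c #|diff_solutions F h c|)%N.
Proof.
move=> p_prime d_gt1 F_plat F_d.
have P_gt0 : (0 < p ^ n)%N by rewrite expn_gt0 prime_gt0.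
have sum_N h : (\sum_c #|diff_solutions F h c| = p ^ n)%N.
  exact: (sum_fiber_card (fun x => F (x + h) - F x) p_prime).
have fib_sqr := sum_fiber_card_sqr p_prime F_d.
(* The fourth moment of the Walsh transform is evaluated in two ways and the common factor q^2, with
   q = p^n, is cancelled. *)
have all_sqr : (\sum_h \sum_c #|diff_solutions F h c| ^ 2 =
    p ^ n * \sum_y #|fiber F y| ^ 2)%N.
  have := sum_walsh_fourth R p_prime F.
  under [LHS]eq_bigr => b _.
    have W0_neq0 : walsh R (component F b) 0 != 0.
      by rewrite walsh0 // (sum_chi_neq0 _ _ _ d_gt1).
    have [r flat] := walsh_flat p_prime b F_plat.
    rewrite (sum_flat_walsh_fourth p_prime flat W0_neq0) walsh0 //.
    over.
  rewrite -mulr_suml (sum_norm_sqr_comp R p_prime F) -natrM => /eqP.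
  by rewrite eqr_nat mulnC eqn_pmul2l ?muln_gt0 ?P_gt0 // => /eqP.
have all_N : (\sum_(h : 'rV['F_p]_n) \sum_c #|diff_solutions F h c| =
    p ^ n * p ^ n)%N.
  under [LHS]eq_bigr do rewrite sum_N.
  by rewrite sum_nat_const card_rVFp.
(* The direction h = 0 contributes q^2 to the squares and q to the plain count; both sides of the
   goal then equal (d - 1) q (q - 1). *)
move: all_sqr all_N; rewrite (bigD1 0) //= sum_diff_solutions0_sqr //.
rewrite [in X in _ -> X -> _](bigD1 0) //= sum_N.
move: fib_sqr P_gt0; clear -d_gt1.
move: (\sum_(h | _) _)%N (\sum_(h | _) _)%N (\sum_y _)%N (p ^ n)%N => S T A P.
by case: d d_gt1 => // d _; rewrite subn1 /=; nia.
Qed.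

(** * The lower bound and the equality case *)

Unset Implicit Arguments.

Theorem theorem5p5 (R : realType) (p n t : nat) (p_prime : prime p)
    (n_gt0 : (0 < n)%N) (d_dvd : (p ^ t + 1 %| p ^ n - 1)%N)
    (F : 'rV['F_p]_n -> 'rV['F_p]_n)
    (F_plateaued : plateaued R F) (F_d_to_1 : d_to_1 (p ^ t + 1) F) :
  (p ^ t <= diff_uniformity F)%N /\
  (diff_uniformity F = (p ^ t)%N <->
   forall a : 'rV['F_p]_n, a != 0 -> forall b : 'rV['F_p]_n,
     #|diff_solutions F a b| = 0%N \/ #|diff_solutions F a b| = (p ^ t)%N).
Proof.
have pt_gt0 : (0 < p ^ t)%N by rewrite expn_gt0 prime_gt0.
have d_gt1 : (1 < p ^ t + 1)%N by lia.
have := sum_diff_solutions_sqr p_prime d_gt1 F_plateaued F_d_to_1.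
rewrite addnK; set N := fun h c => #|diff_solutions F h c| => sum_sqr.
have N_le h c : h != 0 -> (N h c <= diff_uniformity F)%N.
  move=> h0; apply: (@leq_trans (\max_c N h c)%N).
    exact: leq_bigmax.
  exact: (leq_bigmax_cond (F := fun h => \max_c N h c)%N).
have sum_N h : (\sum_c N h c = p ^ n)%N.
  exact: (sum_fiber_card (fun x => F (x + h) - F x) p_prime).
have [h0 h0_neq0] : exists h : 'rV['F_p]_n, h != 0.
  exists (const_mx 1); apply/rV0Pn; exists (Ordinal n_gt0).
  by rewrite mxE oner_eq0.
have N_pos h : exists c, (0 < N h c)%N.
  apply/existsP; apply: contraT; rewrite negb_exists => /forallP N0.
  have := sum_N h; rewrite big1 => [|c _]; last by have := N0 c; lia.
  by move=> /eqP; rewrite eq_sym expn_eq0 eqn0Ngt prime_gt0.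
(* Assuming only an inequality serves both claims: the strict case is refuted for the lower bound,
   and the equality case is the forward implication. *)
have N_val : (diff_uniformity F <= p ^ t)%N ->
    forall h, h != 0 -> forall c, N h c = 0%N \/ N h c = (p ^ t)%N.
  move=> DU_le.
  have N_sqr_le h c : h != 0 -> (N h c ^ 2 <= p ^ t * N h c)%N.
    move=> hn0; rewrite -mulnn leq_mul2r; apply/orP; right.
    exact: leq_trans (N_le h c hn0) DU_le.
  move=> h hn0 c.
  have : (N h c ^ 2 == p ^ t * N h c)%N.
    move: sum_sqr; rewrite big_distrr /= => /eqP.
    (* Equal sums of termwise comparable quantities agree term by term; this is used first over h,
       then over c. *)
    rewrite (@leqif_sum _ _ (fun h => \sum_c N h c ^ 2 == p ^ t * \sum_c N h c)%N).
      move=> /forall_inP/(_ h hn0).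
      rewrite big_distrr /=.
      rewrite (@leqif_sum _ _ (fun c => N h c ^ 2 == p ^ t * N h c)%N).
        by move=> /forall_inP/(_ c isT).
      by move=> c' _; apply/leqif_eq/N_sqr_le.
    move=> h' h'0; apply/leqif_eq; rewrite big_distrr /=.
    by apply: leq_sum => c' _; apply: N_sqr_le.
  by rewrite -mulnn eqn_mul2r => /orP[/eqP|/eqP]; [left|right].
have DU_ge : (p ^ t <= diff_uniformity F)%N.
  (* If the uniformity were below p^t, a positive count in direction [h0] would equal p^t by [N_val]
     and so exceed the maximum. *)
  rewrite leqNgt; apply/negP => DU_lt; have [c Nc] := N_pos h0.
  have := N_le h0 c h0_neq0.
  by case: (N_val (ltnW DU_lt) h0 h0_neq0 c); lia.
split=> //; split=> [DU_eq|N_val'].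
  by apply: N_val; rewrite DU_eq.
apply/eqP; rewrite eqn_leq DU_ge andbT.
apply/bigmax_leqP => h hn0; apply/bigmax_leqP => c _.
by case: (N_val' h hn0 c) => ->.
Qed.
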